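(* Consider the Online Linear Optimization problem with playing set $K$ and gain set $\mathcal{G}$. If $K$ is $\lambda$-strongly convex with respect to a norm $\|\cdot\|$ and all vectors in $\mathcal{G}$ are non-negative (i.e. $\mathcal{G} \subseteq \mathbb{R}^d_+$), then Follow the Leader has regret at most $\frac{C\cdot M}{\lambda}\cdot \log T$, where $M := \max_{g\in\mathcal{G}}\|g\|$ and $C$ is a constant depending only on the norm $\|\cdot\|$.
   Context: Online Linear Optimization: a convex body $K\subseteq\mathbb{R}^d$ (playing set) and a set $\mathcal{G}\subseteq \mathbb{R}^d$ of gain vectors are given. At each time $t=1,\dots,T$ the algorithm chooses $x_t\in K$ using only $g_1,\dots,g_{t-1}$; then a gain vector $g_t\in\mathcal{G}$ is revealed and the algorithm gains $\langle g_t, x_t\rangle$. The regret is $\max_{x\in K}\sum_{t=1}^T\langle g_t,x\rangle - \sum_{t=1}^T\langle g_t,x_t\rangle$. Follow the Leader (FTL): with $s_t := g_1+\dots+g_t$, $x_1$ is an arbitrary point of $K$ and for $t\ge 2$, $x_t \in \arg\max_{x\in K}\langle s_{t-1},x\rangle$. A convex body $K$ is $\lambda$-strongly convex with respect to a norm $\|\cdot\|$ with unit ball $C$ if for all $x,y\in K$, $\frac{x+y}{2} + \lambda\|x-y\|^2\cdot C \subseteq K$.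
   Formalization: The bound is stated for T ≥ 2 only: at T = 1, log T = 0 while the regret can be positive because the first point x_1 is arbitrary (e.g. K the unit disc, g_1 = e_1, x_1 = -e_1 gives regret 2). *)

(* Defs.v *)
From mathcomp Require Import all_boot all_order all_algebra.
From mathcomp Require Import all_classical all_reals all_analysis.
Import Order.TTheory GRing.Theory Num.Theory.
Import numFieldNormedType.Exports.

Set Implicit Arguments.
Unset Strict Implicit.
Unset Printing Implicit Defensive.

Local Open Scope classical_set_scope.
Local Open Scope ring_scope.

Section Definitions.
Context {R : realType} {d : nat}.
Implicit Types (K G A : set 'rV[R]_d) (N : 'rV[R]_d -> R).

Definition dot (u v : 'rV[R]_d) : R := \sum_(i < d) u 0 i * v 0 i.

(* An arbitrary norm on R^d, as opposed to the sup norm `|x| that the library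
   puts on 'rV[R]_d (which is used only for its topology). Nonnegativity
   follows from these three axioms. *)
Record is_norm N : Prop := IsNorm {
  norm_triangle : forall x y, N (x + y) <= N x + N y;
  norm_scale : forall (a : R) x, N (a *: x) = `|a| * N x;
  norm_definite : forall x, N x = 0 -> x = 0 }.

Definition unit_ball N : set 'rV[R]_d := [set z | N z <= 1].

Definition convex_body K : Prop :=
  [/\ compact K, convex_set K & K° !=set0].

Definition strongly_convex N (lambda : R) K : Prop :=
  forall x y, K x -> K y ->
    [set 2^-1 *: (x + y) + (lambda * N (x - y) ^+ 2) *: z | z in unit_ball N]
      `<=` K.

Definition nonneg_vectors : set 'rV[R]_d := [set g | forall i, 0 <= g 0 i].

Definition is_max (S : set R) (m : R) : Prop := S m /\ ubound S m.

Definition argmax K (f : 'rV[R]_d -> R) : set 'rV[R]_d :=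
  [set x | K x /\ forall y, K y -> f y <= f x].

(* Sequences indexed by time are functions of nat of which only the values at
   times 1, ..., T are relevant. *)
Definition partial_sum (g : nat -> 'rV[R]_d) (t : nat) : 'rV[R]_d :=
  \sum_(1 <= i < t.+1) g i.

(* x is a possible run of Follow the Leader against g up to time T: the first
   point and all tie-breaking choices are arbitrary. *)
Definition follow_the_leader K (T : nat) (g x : nat -> 'rV[R]_d) : Prop :=
  K (x 1%N) /\
  forall t, (2 <= t <= T)%N -> argmax K (dot (partial_sum g t.-1)) (x t).

(* The supremum is a maximum when K is compact and nonempty: see
   [best_gain_max]. *)
Definition best_gain K (T : nat) (g : nat -> 'rV[R]_d) : R :=
  sup [set \sum_(1 <= t < T.+1) dot (g t) x | x in K].

Definition regret K (T : nat) (g x : nat -> 'rV[R]_d) : R :=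
  best_gain K T g - \sum_(1 <= t < T.+1) dot (g t) (x t).

Lemma best_gain_max K (T : nat) (g : nat -> 'rV[R]_d) : convex_body K ->
  is_max [set \sum_(1 <= t < T.+1) dot (g t) x | x in K] (best_gain K T g).
Proof.
move=> [cK _ [x0 /interior_subset Kx0]].
pose f (x : 'rV[R]_d) : R := \sum_(1 <= t < T.+1) dot (g t) x.
have cdot u : continuous (dot u).
  apply: (@continuous_big R^o 'I_d +%R 0 xpredT) => [|i _ x].
    exact: (@add_continuous R^o).
  by apply: continuousM; [exact: cst_continuous|exact: coord_continuous].
have cf : {within K, continuous f}.
  apply: continuous_subspaceT.
  apply: (@continuous_big R^o nat +%R 0 xpredT) => [|t _]; last exact: cdot.
  exact: (@add_continuous R^o).
have [|c /set_mem Kc cmax] := EVT_max_rV _ cK cf; first by exists x0.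
have ub : ubound (f @` K) (f c).
  by move=> _ [x Kx <-]; apply: cmax; exact/mem_set.
suff -> : best_gain K T g = f c by split=> //; exists c.
apply/eqP; rewrite eq_le; apply/andP; split.
  by apply: ge_sup => //; exists (f x0); exists x0.
by apply: ub_le_sup; [exists (f c)|exists c].
Qed.

End Definitions.

(* Main.v *)
(* Let [s_t = g_1 + ... + g_t], let [x_(T+1)] be a maximizer of [s_T], and write
   [|u|] for the sup norm and [|u|_1] for the sum of the coordinates of a
   non-negative [u]. The regret is at most the sum of the
   [<g_t, x_(t+1) - x_t>]. As [x_(t+1)] maximizes [s_t], pushing the midpoint of
   [x_t] and [x_(t+1)] inside [K] in the direction [(1, ..., 1)] shows that
   [<s_t, x_(t+1) - x_t>] is at least
   [2 * lambda * N (x_(t+1) - x_t) ^+ 2 * |s_t|_1 / N (1, ..., 1)]; it is at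
   most [<g_t, x_(t+1) - x_t>] since [x_t] maximizes [s_(t-1)]. With
   [<g_t, u> <= |g_t|_1 * |u|] and [|u| <= kappa * N u], each term of the regret
   is [O(|g_t|_1 ^+ 2 / |s_t|_1) / lambda]. Non-negativity makes [|s_t|_1] the
   sum of the [|g_i|_1], and the resulting sum grows logarithmically. *)
Require Import Defs.
From mathcomp Require Import all_boot all_order all_algebra.
From mathcomp Require Import all_classical all_reals all_analysis.
From mathcomp Require Import ring lra.
Import Order.TTheory GRing.Theory Num.Theory.
Import numFieldNormedType.Exports.
Local Open Scope classical_set_scope.
Local Open Scope ring_scope.

(** * Comparison of an arbitrary norm with the sup norm *)

Section Norms.
Context {R : realType} {d : nat} {N : 'rV[R]_d -> R}.
Hypothesis normN : is_norm N.

Lemma is_norm0 : N 0 = 0.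
Proof. by rewrite -[X in N X](scale0r 0) (norm_scale normN) normr0 mul0r. Qed.

Lemma is_normN u : N (- u) = N u.
Proof. by rewrite -scaleN1r (norm_scale normN) normrN1 mul1r. Qed.

Lemma is_norm_ge0 u : 0 <= N u.
Proof.
have := norm_triangle normN u (- u); rewrite subrr is_norm0 is_normN; lra.
Qed.

Lemma is_norm_sum (I : Type) (r : seq I) (F : I -> 'rV[R]_d) :
  N (\sum_(i <- r) F i) <= \sum_(i <- r) N (F i).
Proof.
elim/big_rec2: _ => [|i y x _ le_xy]; first by rewrite is_norm0.
by apply: le_trans (norm_triangle normN _ _) _; rewrite lerD2l.
Qed.

Lemma coord_le_norm (u : 'rV[R]_d) i : `|u 0 i| <= `|u|.
Proof.
rewrite [leRHS]mx_normrE.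
by rewrite (le_trans _ (le_bigmax _ _ ((0 : 'I_1), i))).
Qed.

Lemma is_norm_le_sup u : N u <= (\sum_(i < d) N (delta_mx 0 i)) * `|u|.
Proof.
rewrite {1}[u]row_sum_delta (le_trans (is_norm_sum _ _ _))// mulr_suml.
apply: ler_sum => i _; rewrite (norm_scale normN) mulrC.
by rewrite ler_wpM2l ?is_norm_ge0 ?coord_le_norm.
Qed.

(** The triangle inequality and [is_norm_le_sup] make [N] Lipschitz for the sup norm. *)
Lemma is_norm_continuous : continuous N.
Proof.
set b := \sum_(i < d) N (delta_mx 0 i).
have b0 : 0 <= b by apply: sumr_ge0 => i _; exact: is_norm_ge0.
have lipN u v : `|N u - N v| <= b * `|u - v|.
  apply: le_trans (is_norm_le_sup _); rewrite ler_norml.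
  have := norm_triangle normN (u - v) v; rewrite subrK.
  have := norm_triangle normN (- (u - v)) u; rewrite is_normN opprB subrK.
  by move=> ? ?; apply/andP; split; lra.
move=> u; apply/(@cvgrPdist_lt R R^o _ (nbhs u) (nbhs_filter u) N (N u)) => e e0.
have b1 : 0 < b + 1 by lra.
have eb : 0 < e / (b + 1) by rewrite divr_gt0.
have := nbhsx_ballx u _ eb; apply: filterS => v.
rewrite -ball_normE/= ltr_pdivlMr// => uv.
apply: le_lt_trans (lipN _ _) _.
by have := normr_ge0 (u - v); lra.
Qed.

(** By compactness [N] attains a positive minimum on the sup-norm unit sphere; [kappa] is its
    inverse, and homogeneity does the rest. *)
Lemma sup_le_is_norm : exists2 kappa, 0 < kappa & forall u, `|u| <= kappa * N u.
Proof.
pose S : set 'rV[R]_d := [set u | `|u| = 1].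
have cS : compact S.
  have -> : S = S `&` [set u | forall i, u ord0 i \in `[-1, 1]].
    rewrite eqEsubset; split=> u; last by case.
    move=> Su; split=> // i; rewrite /= in_itv/= -ler_norml -Su.
    exact: coord_le_norm.
  rewrite setIC; apply: compact_closedI.
    apply: (@rV_compact R^o _ (fun=> `[-1, 1]%classic)) => i.
    exact: segment_compact.
  apply: (@preimage_closed _ R^o (fun u : 'rV[R]_d => `|u|) [set x | x = 1]).
    by move=> u _; exact: norm_continuous.
  exact: closed_eq.
(* An empty sphere means that there is no nonzero vector ([d = 0]), so any positive [kappa]
   works. *)
have [S0|/set0P/negP/negPn/eqP S0] := pselect (S !=set0); last first.
  exists 1 => // u; have [->|u0] := eqVneq u 0.
    by rewrite is_norm0 normr0 mulr0.
  have : S (`|u|^-1 *: u).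
    by rewrite /S/= mx_normZ normfV normr_id mulVf ?normr_eq0.
  by rewrite S0.
have [c /set_mem Sc cmin] :=
  EVT_min_rV S0 cS (continuous_subspaceT is_norm_continuous).
have Nc : 0 < N c.
  rewrite lt_def is_norm_ge0 andbT; apply/eqP => /(norm_definite normN) c0.
  by move: Sc; rewrite /S/= c0 normr0 => /esym/eqP; rewrite oner_eq0.
exists (N c)^-1; first by rewrite invr_gt0.
move=> u; have [->|u0] := eqVneq u 0; first by rewrite is_norm0 normr0 mulr0.
have nu : 0 < `|u| by rewrite normr_gt0.
have : S (`|u|^-1 *: u).
  by rewrite /S/= mx_normZ normfV normr_id mulVf ?normr_eq0.
move=> /mem_set/cmin; rewrite (norm_scale normN) normfV normr_id.
by rewrite ler_pdivlMl// mulrC => ?; rewrite ler_pdivlMl// mulrC.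
Qed.

End Norms.

(** * Inner products, cumulative gains and the be-the-leader inequality *)

Section Dot.
Context {R : realType} {d : nat}.
Implicit Types u v w : 'rV[R]_d.

Lemma dotDr u v w : dot u (v + w) = dot u v + dot u w.
Proof. by rewrite /dot -big_split/=; apply: eq_bigr => i _; rewrite mxE mulrDr. Qed.

Lemma dotDl u v w : dot (u + v) w = dot u w + dot v w.
Proof. by rewrite /dot -big_split/=; apply: eq_bigr => i _; rewrite mxE mulrDl. Qed.

Lemma dotZr u a v : dot u (a *: v) = a * dot u v.
Proof. by rewrite /dot mulr_sumr; apply: eq_bigr => i _; rewrite mxE mulrCA. Qed.

Lemma dot0l v : dot 0 v = 0.
Proof. by rewrite /dot big1// => i _; rewrite mxE mul0r. Qed.

Lemma dotNr u v : dot u (- v) = - dot u v.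
Proof. by rewrite -scaleN1r dotZr mulN1r. Qed.

Lemma dotBr u v w : dot u (v - w) = dot u v - dot u w.
Proof. by rewrite dotDr dotNr. Qed.

Lemma dot_partial_sum (g : nat -> 'rV[R]_d) T v :
  dot (partial_sum g T) v = \sum_(1 <= t < T.+1) dot (g t) v.
Proof.
rewrite /partial_sum; elim/big_rec2: _ => [|i x y _ <-]; first exact: dot0l.
by rewrite dotDl.
Qed.

Lemma partial_sumS (g : nat -> 'rV[R]_d) t :
  partial_sum g t.+1 = partial_sum g t + g t.+1.
Proof. by rewrite /partial_sum big_nat_recr. Qed.

(** This is Hölder's inequality: for non-negative [u], [dot u (const_mx 1)] is the sum norm of
    [u]. *)
Lemma dot_le_sup_norm u v :
  nonneg_vectors u -> dot u v <= dot u (const_mx 1) * `|v|.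
Proof.
move=> u0; rewrite /dot mulr_suml; apply: ler_sum => i _; rewrite mxE mulr1.
by rewrite ler_wpM2l// (le_trans (ler_norm _))// coord_le_norm.
Qed.

Lemma dot_const1_le u : dot u (const_mx 1) <= d%:R * `|u|.
Proof.
have -> : d%:R * `|u| = \sum_(i < d) `|u|.
  by rewrite sumr_const card_ord mulr_natl.
apply: ler_sum => i _; rewrite mxE mulr1.
by rewrite (le_trans (ler_norm _))// coord_le_norm.
Qed.

Lemma dot_const1_ge0 u : nonneg_vectors u -> 0 <= dot u (const_mx 1).
Proof. by move=> u0; apply: sumr_ge0 => i _; rewrite mxE mulr1. Qed.

(** Induction on [T]: once the last gain is removed from both sides, the new leader is replaced by
    the previous one, which does at least as well on the shorter sum. *)
Lemma be_the_leader K (T : nat) (g y : nat -> 'rV[R]_d) :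
  (forall t, (1 <= t <= T)%N -> argmax K (dot (partial_sum g t)) (y t.+1)) ->
  dot (partial_sum g T) (y T.+1) <= \sum_(1 <= t < T.+1) dot (g t) (y t.+1).
Proof.
elim: T => [_|T IH lead].
  by rewrite big_geq// /partial_sum big_geq// dot0l.
rewrite big_nat_recr//= partial_sumS dotDl lerD2r.
apply: le_trans (IH _); last first.
  by move=> t /andP[t1 tT]; apply: lead; rewrite t1 leqW.
case: T {IH} lead => [|T] lead; first by rewrite /partial_sum big_geq// !dot0l.
have [Ky _] := lead T.+2 (leqnn _).
by have [_ ymax] := lead T.+1 (leqnSn _); exact: ymax.
Qed.

End Dot.

(** * Logarithmic growth of the sum of squares over prefix sums *)

(* [m = 0] is allowed: then [a] vanishes and every quotient is [0 / 0 = 0]. *)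
Lemma sum_sqr_div_le_ln (R : realType) (a : nat -> R) (m : R) (T : nat) :
  (forall t, (1 <= t <= T)%N -> 0 <= a t <= m) ->
  \sum_(1 <= t < T.+1) a t ^+ 2 / (\sum_(1 <= i < t.+1) a i)
    <= 2 * m * ln (1 + T%:R).
Proof.
case: T => [_|T a_le]; first by rewrite big_geq// addr0 ln1 mulr0.
have m_ge0 : 0 <= m by have /andP[] := a_le 1%N isT; exact: le_trans.
have [m0|m_neq0] := eqVneq m 0.
  rewrite m0 mulr0 mul0r big_nat big1// => t /a_le; rewrite m0 => /le_anti <-.
  by rewrite expr0n mul0r.
have m_gt0 : 0 < m by rewrite lt_def m_neq0.
pose A n := \sum_(1 <= i < n.+1) a i.
have AS n : A n.+1 = A n + a n.+1 by rewrite /A big_nat_recr.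
(* Each step increases [2 * m * ln (1 + A n / m)] by at least the new term. *)
suff pot n : (n <= T.+1)%N -> 0 <= A n <= n%:R * m /\
    \sum_(1 <= t < n.+1) a t ^+ 2 / A t <= 2 * m * ln (1 + A n / m).
  have [/andP[A0 AT] /le_trans] := pot T.+1 (leqnn _); apply.
  rewrite ler_pM2l ?mulr_gt0// ler_ln ?posrE ?ltr_wpDr ?divr_ge0//.
  by rewrite lerD2l ler_pdivrMr.
elim: n => [_|n IH nT].
  by rewrite /A !big_geq// mul0r lexx mul0r addr0 ln1 mulr0.
have [/andP[A0 An] IHn] := IH (ltnW nT).
have /andP[a0 am] := a_le n.+1 nT.
split; first by rewrite AS -natr1; apply/andP; split; lra.
rewrite big_nat_recr//=.
have AS0 : 0 <= A n.+1 by rewrite AS addr_ge0.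
have p0 : 0 < 1 + A n / m by rewrite ltr_wpDr ?divr_ge0.
have pS0 : 0 < 1 + A n.+1 / m by rewrite ltr_wpDr ?divr_ge0.
(* This is [ln (1 + x) <= x] at [x = - (a n.+1 / (m + A n.+1))], applied to the inverse ratio of the
   two arguments. *)
have step : a n.+1 / (m + A n.+1) <= ln (1 + A n.+1 / m) - ln (1 + A n / m).
  rewrite -ln_div ?posrE// -[leRHS]opprK -lnV ?posrE ?divr_gt0// invf_div lerNr.
  have -> : (1 + A n / m) / (1 + A n.+1 / m) = 1 + - (a n.+1 / (m + A n.+1)).
    by rewrite AS; field; rewrite m_neq0 andbT; apply/lt0r_neq0; lra.
  by apply: le_ln1Dx; rewrite ltrN2 ltr_pdivrMr AS; lra.
(* After clearing denominators, what matters is [a * (m + A) <= 2 * m * A], which follows from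
   [a <= A] and [a <= m]. *)
have quot : a n.+1 ^+ 2 / A n.+1 <= 2 * m * (a n.+1 / (m + A n.+1)).
  have [A00|An0] := eqVneq (A n.+1) 0.
    by rewrite A00 invr0 mulr0 !mulr_ge0// addr0 invr_ge0.
  have AS1 : 0 < A n.+1 by rewrite lt_def An0.
  have aA : a n.+1 <= A n.+1 by rewrite AS; lra.
  rewrite ler_pdivrMr// mulrA -mulrAC ler_pdivlMr; last lra.
  suff : 0 <= a n.+1 * (m * (A n.+1 - a n.+1) + A n.+1 * (m - a n.+1)) by lra.
  by rewrite mulr_ge0// addr_ge0// mulr_ge0// subr_ge0.
have := ler_wpM2l (_ : 0 <= 2 * m) step; rewrite mulr_ge0// => /(_ isT); lra.
Qed.

(** * Stability of leaders on a strongly convex body *)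

Section Stability.
Context {R : realType} {d : nat} {N : 'rV[R]_d -> R} {K : set 'rV[R]_d}.
Context {lambda : R}.
Hypotheses (normN : is_norm N) (scK : strongly_convex N lambda K).

(* The point of [K] at distance [lambda * N (x - y) ^+ 2] from the midpoint of
   [x] and [y] in the direction of the all-ones vector cannot beat [y]. *)
Lemma argmax_gap s x y : 0 < N (const_mx 1) -> K x -> argmax K (dot s) y ->
  2 * lambda * N (y - x) ^+ 2 * dot s (const_mx 1)
    <= dot s (y - x) * N (const_mx 1).
Proof.
move=> nu0 Kx [Ky ymax].
set z := (N (const_mx 1))^-1 *: const_mx 1 : 'rV[R]_d.
have Nz : unit_ball N z.
  rewrite /unit_ball/= /z (norm_scale normN) ger0_norm ?invr_ge0 ?(ltW nu0)//.
  by rewrite mulVf// gt_eqF.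
have : K (2^-1 *: (y + x) + (lambda * N (y - x) ^+ 2) *: z).
  by apply: (scK _ _ Ky Kx); exists z.
move=> /ymax; rewrite dotBr (dotDr s (_ *: _)) /z !dotZr dotDr => le_y.
by rewrite -ler_pdivrMr//; lra.
Qed.

(** By [argmax_gap], with [s] traded for [g] through the last hypothesis, [N (y - x) ^+ 2] is at
    most linear in the gain [dot g (y - x)]; by Hölder the gain is at most linear in [N (y - x)].
    Eliminating [N (y - x)] bounds the squared gain by a multiple of the gain, and one factor
    cancels. *)
Lemma leader_stability kappa g s x y :
  0 < lambda -> 0 < kappa -> (forall u, `|u| <= kappa * N u) ->
  0 < N (const_mx 1) ->
  nonneg_vectors g -> dot g (const_mx 1) <= dot s (const_mx 1) ->
  K x -> argmax K (dot s) y -> dot s (y - x) <= dot g (y - x) ->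
  dot g (y - x) <= kappa ^+ 2 * N (const_mx 1) / (2 * lambda)
    * (dot g (const_mx 1) ^+ 2 / dot s (const_mx 1)).
Proof.
move=> lambda0 kappa0 kappaN nu0 g0 le_gs Kx ymax le_sg.
have gap := argmax_gap _ _ _ nu0 Kx ymax.
set nu := N (const_mx 1) in gap nu0 *.
set n := N (y - x) in gap.
set p := dot g (y - x) in le_sg *.
set a := dot g (const_mx 1) in le_gs *.
set A := dot s (const_mx 1) in gap le_gs *.
have a0 : 0 <= a := dot_const1_ge0 _ g0.
have p_le : p <= a * (kappa * n).
  by apply: le_trans (dot_le_sup_norm _ _ g0) _; rewrite ler_wpM2l.
(* Cancelling [p] needs [p > 0]. Otherwise it suffices that the right side is non-negative, even
   when [A = 0]. *)
have [p0|p0] := leP p 0.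
  have A_ge0 : 0 <= A := le_trans a0 le_gs.
  apply: (le_trans p0); apply: mulr_ge0; apply: divr_ge0 => //.
  - by rewrite mulr_ge0 ?exprn_ge0 ?ltW.
  - by rewrite mulr_ge0 ?ltW.
  - exact: exprn_ge0.
have A0 : 0 < A.
  apply: lt_le_trans le_gs; rewrite lt_def a0 andbT.
  by apply/eqP => a00; move: p_le; rewrite a00 mul0r; lra.
have pgap : 2 * lambda * n ^+ 2 * A <= p * nu.
  by apply: le_trans gap _; rewrite ler_pM2r.
have psqr : p ^+ 2 <= a ^+ 2 * kappa ^+ 2 * n ^+ 2.
  rewrite -mulrA -!exprMn; apply: lerXn2r; rewrite ?nnegrE ?(ltW p0)//.
  exact: le_trans (ltW p0) p_le.
rewrite mulf_div ler_pdivlMr ?mulr_gt0//.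
rewrite -(ler_pM2l p0).
have A2_ge0 : 0 <= 2 * lambda * A by rewrite !mulr_ge0 ?ltW.
have ak_ge0 : 0 <= a ^+ 2 * kappa ^+ 2 by rewrite mulr_ge0 ?sqr_ge0.
have := ler_wpM2l A2_ge0 psqr; have := ler_wpM2l ak_ge0 pgap; lra.
Qed.

End Stability.

(** * Assembly of the regret bound *)

Theorem theorem3 (R : realType) (d : nat) (N : 'rV[R]_d -> R) :
  is_norm N ->
  exists C : R,
    forall (K G : set 'rV[R]_d) (lambda M : R),
      convex_body K ->
      0 < lambda ->
      strongly_convex N lambda K ->
      G `<=` nonneg_vectors ->
      is_max [set N g | g in G] M ->
      forall (T : nat) (g x : nat -> 'rV[R]_d),
        (2 <= T)%N ->
        (forall t : nat, (1 <= t <= T)%N -> G (g t)) ->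
        follow_the_leader K T g x ->
        regret K T g x <= C * M / lambda * ln T%:R.
Proof.
move=> normN; have [kappa kappa0 kappaN] := sup_le_is_norm normN.
pose nu := N (const_mx 1).
(* The constant is the product of [kappa ^+ 2 * nu / 2] from stability, [2 * d%:R * kappa] from the
   logarithmic sum, and 2 from replacing [ln (1 + T)] by [ln T]. *)
exists (2 * d%:R * kappa ^+ 3 * nu) => K G lambda M cK lambda0 scK G0 [_ maxM].
move=> T g x T2 Gg [Kx1 ftl].
have [[xs Kxs xsE] xs_max] := best_gain_max T g cK.
(* The run is extended at time [T + 1] by the best fixed point, so that [y t.+1] leads after round
   [t] for every [t] up to [T]. *)
pose y t := if (t <= T)%N then x t else xs.
have y_argmax t : (1 <= t <= T)%N -> argmax K (dot (partial_sum g t)) (y t.+1).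
  move=> /andP[t1 tT]; rewrite /y; case: ifPn => [tT'|].
    by apply: (ftl t.+1); rewrite ltnS t1.
  rewrite -leqNgt => Tt; have -> : t = T by apply/anti_leq; rewrite tT.
  split=> // u Ku; rewrite !dot_partial_sum xsE.
  by apply: xs_max; exists u.
have Ky t : (1 <= t)%N -> (t <= T.+1)%N -> K (y t).
  case: t => [//|[_ _|t _ tT]]; first by rewrite /y (ltnW T2).
  by have [] := y_argmax t.+1 tT.
have btl : regret K T g x <= \sum_(1 <= t < T.+1) dot (g t) (y t.+1 - y t).
  have := be_the_leader _ _ _ _ y_argmax.
  rewrite /y ltnn dot_partial_sum xsE -/(y _) => lead.
  rewrite (eq_bigr (fun t => dot (g t) (y t.+1) - dot (g t) (y t))); last first.
    by move=> t _; rewrite dotBr.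
  rewrite sumrB /regret; apply: lerB => //.
  apply: ler_sum_nat => t /andP[_ tT].
  by rewrite /y; move: tT; rewrite ltnS => ->.
apply: le_trans btl _.
(* In dimension 0 the all-ones vector is zero and [nu] vanishes, but so do both sides. *)
have [d0|d_gt0] := posnP d.
  subst d; rewrite !(mulr0, mul0r) big1// => t _.
  by rewrite /dot big_ord0.
have nu0 : 0 < nu.
  rewrite lt_def is_norm_ge0// andbT; apply/eqP => /(norm_definite normN).
  move=> /matrixP/(_ 0 (Ordinal d_gt0)); rewrite !mxE => /eqP.
  by rewrite oner_eq0.
pose a t := dot (g t) (const_mx 1).
have A_sum t : dot (partial_sum g t) (const_mx 1) = \sum_(1 <= i < t.+1) a i.
  exact: dot_partial_sum.
pose m := d%:R * (kappa * M).
have a_bound t : (1 <= t <= T)%N -> 0 <= a t <= m.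
  move=> tT; have Ggt := Gg t tT; rewrite (dot_const1_ge0 _ (G0 _ Ggt))/=.
  apply: le_trans (dot_const1_le _) _; rewrite ler_wpM2l//.
  by apply: le_trans (kappaN _) _; rewrite ler_pM2l//; apply: maxM; exists (g t).
pose c := kappa ^+ 2 * nu / (2 * lambda).
have c0 : 0 <= c by rewrite divr_ge0// ?mulr_ge0 ?exprn_ge0 ?ltW.
have m0 : 0 <= m.
  have T1 : (1 <= T <= T)%N by rewrite leqnn (ltnW T2).
  by have /andP[] := a_bound T T1; exact: le_trans.
apply: (@le_trans _ _ (c * (2 * m * ln (1 + T%:R)))).
  apply: le_trans (ler_wpM2l c0 (sum_sqr_div_le_ln _ _ _ _ a_bound)).
  rewrite mulr_sumr; apply: ler_sum_nat => t /andP[t1 tT].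
  have tT' : (1 <= t <= T)%N by rewrite t1.
  rewrite -A_sum; apply: (leader_stability normN scK) => //.
  - exact: (G0 _ (Gg _ tT')).
  - rewrite A_sum big_nat_recr//= lerDr big_nat_cond sumr_ge0// => i.
    rewrite andbT => /andP[i1 it].
    have iT : (1 <= i <= T)%N by rewrite i1 (leq_trans (ltnW it)).
    by have /andP[] := a_bound i iT.
  - by apply: Ky => //; exact: ltnW.
  - exact: y_argmax.
  - case: t {tT} t1 tT' => [//|t] _ /andP[_ tT].
    rewrite partial_sumS dotDl gerDr dotBr subr_le0.
    (* The first point is arbitrary and maximizes nothing by choice, but the empty sum of gains is
       zero there. *)
    case: t tT => [|t] tT; first by rewrite /partial_sum big_geq// !dot0l.
    have [_ ymax] := y_argmax t.+1 (ltnW tT).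
    by apply: ymax; exact: Ky.
(* Here [2 <= T] is essential: it gives [1 + T <= T ^ 2]. *)
have lnT : ln (1 + T%:R) <= 2 * ln T%:R :> R.
  have T0 : (0 : R) < T%:R by rewrite ltr0n (leq_trans _ T2).
  rewrite mulr_natl -lnXn// ler_ln ?posrE ?exprn_gt0// ?addr_gt0//.
  rewrite nat1r -natrX ler_nat -mulnn.
  apply: leq_trans (leq_mul (leqnn T) T2).
  by rewrite muln2 -addnn -addn1 leq_add2l ltnW.
have -> : 2 * d%:R * kappa ^+ 3 * nu * M / lambda * ln T%:R
    = c * (2 * m * (2 * ln T%:R)).
  by rewrite /c /m; field; rewrite gt_eqF.
by rewrite ler_wpM2l// ler_wpM2l// mulr_ge0.
Qed.
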